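(* There is a universal constant $c>0$, and for every $q\ge1$ a constant $\kappa_q>0$ depending only on $q$, such that the following holds. Let $n,m\in\mathbb{N}$ and $A,S\ge1$, and assume that the probability measures $\nu_1,\dots,\nu_n$ on $\mathbb{Z}_m^n$ and $\beta_1,\beta_2$ on $E_\infty(\mathbb{Z}_m^n)$ are a $(q,A,S)$-smoothing and approximation scheme on $\mathbb{Z}_m^n$. If $m>cA$, then $$S\ge \kappa_q\,\frac{\sqrt n}{A}.$$
   Context: $\mathbb{Z}_m=\mathbb{Z}/m\mathbb{Z}$, and $e_1,\dots,e_n$ is the standard basis of $\mathbb{Z}_m^n$. $\mu$ is the uniform probability measure on $\mathbb{Z}_m^n$ and $\tau$ is the uniform probability measure on $\{-1,1\}^n$. $$E_\infty(\mathbb{Z}_m^n)=\{(x,y)\in\mathbb{Z}_m^n\times\mathbb{Z}_m^n:\ x-y\in\{-1,0,1\}^n\}.$$ For a Banach space $X$, $f:\mathbb{Z}_m^n\to X$ and a probability measure $\nu$ on $\mathbb{Z}_m^n$, $f*\nu(x)=\int_{\mathbb{Z}_m^n}f(x-y)\,d\nu(y)$. For $A,S,q\ge1$, probability measures $\nu_1,\dots,\nu_n$ on $\mathbb{Z}_m^n$ and $\beta_1,\beta_2$ on $E_\infty(\mathbb{Z}_m^n)$ are a $(q,A,S)$-smoothing and approximation scheme on $\mathbb{Z}_m^n$ if for every Banach space $(X,\|\cdot\|_X)$ and every $f:\mathbb{Z}_m^n\to X$ both of the following hold. Approximation property: $$\frac1n\sum_{j=1}^n\int_{\mathbb{Z}_m^n}\|f*\nu_j(x)-f(x)\|_X^q\,d\mu(x)\le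 A^q\int_{E_\infty(\mathbb{Z}_m^n)}\|f(x)-f(y)\|_X^q\,d\beta_1(x,y).$$ Smoothing property: $$\int_{\mathbb{Z}_m^n}\int_{\{-1,1\}^n}\Big\|\sum_{j=1}^n\varepsilon_j\big(f*\nu_j(x+e_j)-f*\nu_j(x-e_j)\big)\Big\|_X^q\,d\tau(\varepsilon)\,d\mu(x)\le S^q\int_{E_\infty(\mathbb{Z}_m^n)}\|f(x)-f(y)\|_X^q\,d\beta_2(x,y).$$ *)

(* Defs.v *)
From HB Require Import structures.
From mathcomp Require Import all_boot all_order all_algebra.
From mathcomp Require Import all_classical all_reals all_analysis.

Set Implicit Arguments.
Unset Strict Implicit.
Unset Printing Implicit Defensive.

Import Order.TTheory GRing.Theory Num.Theory.
Import numFieldNormedType.Exports.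

Local Open Scope classical_set_scope.
Local Open Scope ring_scope.

(* Z/mZ is ['I_m.-1.+1] rather than ['Z_m], whose modulus is 2 when m = 1;
   for m > 0 the carrier is ['I_m] with addition modulo m. *)
Definition Zmod (m : nat) := 'I_m.-1.+1.
HB.instance Definition _ (m : nat) := Finite.on (Zmod m).
HB.instance Definition _ (m : nat) := GRing.Zmodule.on (Zmod m).

Definition Zmod1 (m : nat) : Zmod m := inZp 1.

Definition torus (m n : nat) := 'rV[Zmod m]_n.
HB.instance Definition _ (m n : nat) := Finite.on (torus m n).
HB.instance Definition _ (m n : nat) := GRing.Zmodule.on (torus m n).
HB.instance Definition _ (m n : nat) := isPointed.Build (torus m n) 0.
HB.instance Definition _ (m n : nat) :=
  @isMeasurable.Build default_measure_display (torus m n) discrete_measurable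
    discrete_measurable0 discrete_measurableC discrete_measurableU.

Definition e_ (m n : nat) (j : 'I_n) : torus m n :=
  \row_(k < n) if k == j then Zmod1 m else 0.

Definition edge (m n : nat) (p : torus m n * torus m n) : bool :=
  [forall k, (p.1 - p.2) 0 k \in [:: - Zmod1 m; 0; Zmod1 m]].

Definition Einfty (m n : nat) := {p : torus m n * torus m n | edge p}.
HB.instance Definition _ (m n : nat) := Finite.on (Einfty m n).

Lemma edge0 (m n : nat) : @edge m n (0, 0).
Proof. by apply/forallP => k; rewrite subrr mxE !inE eqxx orbT. Qed.

HB.instance Definition _ (m n : nat) :=
  isPointed.Build (Einfty m n) (Sub (0, 0) (edge0 m n)).
HB.instance Definition _ (m n : nat) :=
  @isMeasurable.Build default_measure_display (Einfty m n) discrete_measurable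
    discrete_measurable0 discrete_measurableC discrete_measurableU.

(* {-1, 1}^n, encoded by the exponents b_j of the signs (-1) ^+ b_j. *)
Definition signs (n : nat) := {ffun 'I_n -> bool}.
HB.instance Definition _ (n : nat) := Finite.on (signs n).
HB.instance Definition _ (n : nat) := isPointed.Build (signs n) [ffun=> false].
HB.instance Definition _ (n : nat) :=
  @isMeasurable.Build default_measure_display (signs n) discrete_measurable
    discrete_measurable0 discrete_measurableC discrete_measurableU.

(* The counting measure of each of the finite spaces above is finite and
   nonzero, so the default probability (here a point mass) is never used. *)
Definition uniform {R : realType} d (T : measurableType d) : probability T R :=
  mnormalize (@counting T R) (@dirac _ T point R).

Section scheme.
Context {R : realType} (m n : nat).

Definition mu : probability (torus m n) R := uniform (torus m n).
Definition tau : probability (signs n) R := uniform (signs n).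

(* An integral over a finite probability space with values in a vector space is
   the sum of the values weighted by the masses of the points. *)
Definition conv (X : completeNormedModType R) (f : torus m n -> X)
    (nu : probability (torus m n) R) (x : torus m n) : X :=
  \sum_(y : torus m n) fine (nu [set y]) *: f (x - y).

Definition edge_energy (q : R) (beta : probability (Einfty m n) R)
    (X : completeNormedModType R) (f : torus m n -> X) : R :=
  \int[beta]_p (`|f (val p).1 - f (val p).2| `^ q).

Definition approximation_property (q A : R)
    (nu : 'I_n -> probability (torus m n) R)
    (beta1 : probability (Einfty m n) R)
    (X : completeNormedModType R) (f : torus m n -> X) : Prop :=
  n%:R^-1 * (\sum_(j < n) \int[mu]_x (`|conv f (nu j) x - f x| `^ q))
    <= A `^ q * edge_energy q beta1 f.

Definition smoothing_property (q S : R)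
    (nu : 'I_n -> probability (torus m n) R)
    (beta2 : probability (Einfty m n) R)
    (X : completeNormedModType R) (f : torus m n -> X) : Prop :=
  \int[mu]_x \int[tau]_b
      (`|\sum_(j < n) (-1) ^+ b j *:
           (conv f (nu j) (x + e_ m j) - conv f (nu j) (x - e_ m j))| `^ q)
    <= S `^ q * edge_energy q beta2 f.

Definition smoothing_approximation_scheme (q A S : R)
    (nu : 'I_n -> probability (torus m n) R)
    (beta1 beta2 : probability (Einfty m n) R) : Prop :=
  forall (X : completeNormedModType R) (f : torus m n -> X),
    approximation_property q A nu beta1 f /\
    smoothing_property q S nu beta2 f.

End scheme.

(* Main.v *)
From HB Require Import structures.
Require Import Defs.
From mathcomp Require Import all_boot all_order all_algebra.
From mathcomp Require Import all_classical all_reals all_analysis.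
From mathcomp Require finmap.
From mathcomp Require Import zify ring lra.

(** The approximation property forces the measures [nu j] to live, on average, at
    scale [A] in the supremum norm; a sum of [n] signed differences of measures at
    this scale must have total mass of order [Num.sqrt n / A] or more, while the
    smoothing property bounds that mass by a multiple of [S].

    For the first claim, test the approximation property on the Kuratowski
    embedding of the torus with the supremum metric ([mean_supabs]). It is
    1-Lipschitz along the edges, and at every point its distance to its
    convolution with [nu j] is at least the first moment of the supremum norm under [nu j]. Hence these
    moments are at most [A] on average over [j].

    For the second claim, test the smoothing property on a family of functions
    bounded by 1, gathered as the coordinates of one map into a supremum-norm
    space ([mean_wave_step]). The edge energy of such a map is at most [2 `^ q]
    whatever the measure on the edges. The functions are the translates of
    [wave theta b], the truncation to the interval from -1 to 1 of
    [theta * \sum_k (-1) ^+ b k * h (y k)]. Here [h] is a periodic function which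
    coincides with the coordinate near 0, at distances up to a fixed proportion
    of [m]; this is where a large ratio [m / A] is used. In the direction [j] the
    difference of [wave theta b] has the sign [(-1) ^+ b j] and size [2 * theta]
    wherever the truncation does not interfere. By orthogonality of the signs the
    sum has variance at most [n * A ^+ 2] at points of norm [A], so with [theta]
    of order [1 / (A * Num.sqrt n)] the truncation is harmless for most [b]
    ([sum_wave_step]). The signed gradient then adds up to order
    [n * theta = Num.sqrt n / A].

    The powers [q] disappear through Jensen's inequality ([powR_mean_le]), so
    both constants can be taken absolute. *)

Set Implicit Arguments.
Unset Strict Implicit.
Unset Printing Implicit Defensive.

Import Order.TTheory GRing.Theory Num.Theory.
Import numFieldNormedType.Exports.
Local Open Scope ring_scope.

(** * The circular absolute value *)

Section cyclic.
Variable m : nat.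
Implicit Types a b : Zmod m.

Definition zabs a : nat := minn a (m.-1.+1 - a).

Lemma val_ZmodD a b :
  nat_of_ord (a + b) = ((nat_of_ord a + nat_of_ord b) %% m.-1.+1)%N.
Proof. by []. Qed.

Lemma zabs0 : zabs 0 = 0%N.
Proof. by rewrite /zabs min0n. Qed.

Lemma zabsN a : zabs (- a) = zabs a.
Proof.
have /= := ltn_ord a.
rewrite /zabs /= => am.
have [->|a0] := posnP (a : nat); first by rewrite subn0 modnn min0n.
by rewrite modn_small; lia.
Qed.

Lemma zabs1 : (zabs (Zmod1 m) <= 1)%N.
Proof. by rewrite /zabs /=; have := leq_mod 1 m.-1.+1; lia. Qed.

Lemma zabsD a b : (zabs (a + b)%R <= zabs a + zabs b)%N.
Proof.
have /= := ltn_ord a; have /= := ltn_ord b => bm am.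
rewrite /zabs val_ZmodD.
have [abm|abm] := ltnP (nat_of_ord a + nat_of_ord b)%N m.-1.+1.
  by rewrite modn_small//; lia.
rewrite -(subnK abm) modnDr modn_small; lia.
Qed.

Lemma zabs_le_add a b : (zabs a <= zabs b + zabs (a - b)%R)%N.
Proof. by rewrite -{1}(subrK b a) addrC; exact: zabsD. Qed.

(** For large [m] a quarter turn moves 0 to the middle of a stretch on which
    [zabs] is affine; [zabs] itself has a corner at 0. *)
Definition quarter : Zmod m := inZp (m %/ 4).

(** A short [a] shifted by [quarter] stays on the increasing branch of [zabs],
    which runs over the residues between 0 and half the modulus. *)
Lemma zabs_shift a : (zabs a + 2 <= m %/ 4)%N ->
  zabs (a + Zmod1 m + quarter) = (zabs (a - Zmod1 m + quarter)%R + 2)%N.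
Proof.
move=> am.
have m8 : (8 <= m)%N by have := leq_trunc_div m 4; lia.
have mE : m.-1.+1 = m by lia.
have := leq_trunc_div m 4; set q := (m %/ 4)%N in am * => qm.
have q1 : nat_of_ord (quarter) = q by rewrite /= -/q modn_small; lia.
have Z1 : nat_of_ord (Zmod1 m) = 1%N by rewrite /= modn_small; lia.
(* v = a - 1 + m/4: the three residues v, v + 1, v + 2 lie on that branch. *)
have [v [av [v1 v2]]] : exists v : Zmod m, a + quarter = v + Zmod1 m /\
    (1 <= nat_of_ord v)%N /\ (nat_of_ord v + 2 <= 2 * q)%N.
  exists (a + quarter - Zmod1 m); split; first by rewrite subrK.
  have am' : (nat_of_ord a < m.-1.+1)%N := ltn_ord a.
  suff -> : nat_of_ord (a + quarter - Zmod1 m : Zmod m) =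
      (if nat_of_ord a < m - nat_of_ord a then nat_of_ord a + q - 1
       else nat_of_ord a + q - 1 - m)%N.
    by move: am; rewrite /zabs; case: ifP; lia.
  move: am; rewrite /zabs => am.
  have N1 : nat_of_ord (- Zmod1 m : Zmod m) = m.-1.
    by rewrite [LHS]/= (modn_small (_ : (1 < _)%N)) ?modn_small; lia.
  rewrite !val_ZmodD q1 N1.
  have [l|l] := ltnP (nat_of_ord a + q)%N m.-1.+1.
    rewrite (modn_small l).
    have -> : (nat_of_ord a + q + m.-1 =
        (nat_of_ord a + q - 1) + m.-1.+1)%N by lia.
    by rewrite modnDr modn_small; do ?case: ifP; lia.
  rewrite -(subnK l) modnDr (modn_small (_ : (_ - m.-1.+1 < _)%N)); last by lia.
  have -> : (nat_of_ord a + q - m.-1.+1 + m.-1 =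
      nat_of_ord a + q - m.-1.+1 - 1 + m.-1.+1)%N by lia.
  by rewrite modnDr modn_small; do ?case: ifP; lia.
rewrite -addrA (addrC (Zmod1 m)) addrA av (addrAC a) av addrK.
suff -> : zabs (v + Zmod1 m + Zmod1 m) = (nat_of_ord v + 2)%N.
  by rewrite /zabs; lia.
rewrite /zabs !val_ZmodD Z1 (modn_small (_ : (nat_of_ord v + 1 < _)%N));
  last by lia.
by rewrite modn_small; lia.
Qed.

End cyclic.

(** * Truncation to the interval from -1 to 1 *)

Section clip.
Variable R : realType.
Implicit Types s t : R.

Definition clip t : R := if 1 < t then 1 else if t < -1 then -1 else t.

Lemma clip_bound t : `|clip t| <= 1.
Proof.
by rewrite /clip ler_norml; do ?case: ltP => *; apply/andP; split; lra.
Qed.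

Lemma clip_mono s t : t <= s -> 0 <= clip s - clip t <= s - t.
Proof.
by move=> ts; rewrite /clip; do ?case: ltP => *; apply/andP; split; lra.
Qed.

Lemma clip_dist s t : `|clip s - clip t| <= `|s - t|.
Proof.
wlog ts : s t / t <= s => [th|].
  by have [/th//|/ltW/th h] := leP t s; rewrite distrC (distrC s).
have /andP[h0 h1] := clip_mono ts.
by rewrite !ger0_norm// subr_ge0.
Qed.

(** If [s] and [t] both lie within the truncation range the truncation does
    nothing; otherwise the left-hand side is nonpositive and monotonicity
    suffices. This polynomial form of the bound can be averaged over random
    signs through second moments alone. *)
Lemma clip_slope s t : t <= s ->
  (s - t) * (1 - s ^+ 2 - t ^+ 2) <= clip s - clip t.
Proof.
move=> ts; have s2 := sqr_ge0 s; have t2 := sqr_ge0 t.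
have [out|inn] := leP 1 (s ^+ 2 + t ^+ 2).
  apply: (@le_trans _ _ 0); first by rewrite mulr_ge0_le0//; lra.
  by case/andP: (clip_mono ts).
have in1 (u : R) : u ^+ 2 < 1 -> clip u = u.
  rewrite expr2 => u1; have a : -1 < u by nra.
  have b : u < 1 by nra.
  by rewrite /clip !ltNge (ltW a) (ltW b).
rewrite !in1; try lra.
rewrite -[leRHS]mulr1 ler_wpM2l//; lra.
Qed.

End clip.

(** * Orthogonality of random signs *)

Section signed.
Context {R : realType} {n : nat}.

Definition sg (b : signs n) (j : 'I_n) : R := (-1) ^+ b j.

Definition flip (j : 'I_n) (b : signs n) : signs n :=
  [ffun k => if k == j then ~~ b k else b k].

Lemma flipK j : involutive (flip j).
Proof.
move=> b; apply/ffunP => k; rewrite !ffunE.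
by case: eqP => // _; rewrite negbK.
Qed.

Lemma sgM b j : sg b j * sg b j = 1.
Proof. by rewrite /sg -expr2 sqrr_sign. Qed.

(** Flipping the [j]-th sign negates the sum when [j != k]. *)
Lemma sg_orthogonal j k :
  \sum_(b : signs n) sg b j * sg b k =
  if j == k then #|{: signs n}|%:R else 0.
Proof.
have [->|jk] := eqVneq j k.
  by rewrite (eq_bigr _ (fun b _ => sgM b k)) sumr_const.
set s := LHS; suff : s = - s by move=> h; lra.
rewrite {1}/s (reindex_inj (can_inj (flipK j))) /s -sumrN.
apply: eq_bigr => b _; rewrite /sg !ffunE eqxx eq_sym (negbTE jk).
by case: (b j); rewrite !(expr0, expr1, mulN1r, mul1r, opprK).
Qed.

Lemma sum_sg_sqr (a : 'I_n -> R) :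
  \sum_(b : signs n) (\sum_k sg b k * a k) ^+ 2 =
  #|{: signs n}|%:R * \sum_k a k ^+ 2.
Proof.
under eq_bigr do rewrite expr2 big_distrlr.
rewrite exchange_big /= mulr_sumr; apply: eq_bigr => j _.
rewrite exchange_big (bigD1 j)//= [X in _ + X]big1 ?addr0; last first.
  move=> k kj; under eq_bigr do rewrite mulrACA.
  by rewrite -mulr_suml sg_orthogonal eq_sym (negbTE kj) mul0r.
under eq_bigr do rewrite mulrACA.
by rewrite -mulr_suml sg_orthogonal eqxx expr2.
Qed.

End signed.

(** * A bounded function with a large signed gradient *)

Section torus.
Context {R : realType} {m n : nat}.
Implicit Types (x y u : torus m n) (b : signs n).

Definition supabs y : nat := \max_(k < n) zabs (y 0%R k).

Lemma zabs_supabs y k : (zabs (y 0%R k) <= supabs y)%N.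
Proof. exact: (leq_bigmax k). Qed.

Lemma supabsD x y : (supabs (x + y)%R <= supabs x + supabs y)%N.
Proof.
apply/bigmax_leqP => k _; rewrite mxE.
by rewrite (leq_trans (zabsD _ _))// leq_add// zabs_supabs.
Qed.

Lemma supabsN y : supabs (- y) = supabs y.
Proof. by apply: eq_bigr => k _; rewrite mxE zabsN. Qed.

Lemma supabs0 : supabs 0 = 0%N.
Proof. by rewrite /supabs big1// => k _; rewrite mxE zabs0. Qed.

Lemma supabs_e j : (supabs (e_ m j) <= 1)%N.
Proof.
apply/bigmax_leqP => k _; rewrite mxE.
by case: eqP => _; rewrite ?zabs1 ?zabs0.
Qed.

Lemma supabs_edge (p : torus m n * torus m n) :
  edge p -> (supabs (p.1 - p.2)%R <= 1)%N.
Proof.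
move=> /forallP ep; apply/bigmax_leqP => k _; have := ep k.
by rewrite !inE => /or3P[] /eqP ->; rewrite ?zabsN ?zabs0 ?zabs1.
Qed.

(** A periodic, 1-Lipschitz substitute for the coordinate function, which has
    slope exactly 1 near 0 when [m] is large. *)
Definition sawtooth (a : Zmod m) : R :=
  (zabs (a + quarter m))%:R - (zabs (quarter m))%:R.

Lemma sawtooth_le a : `|sawtooth a| <= (zabs a)%:R.
Proof.
have h1 := zabsD a (quarter m).
have := zabs_le_add (quarter m) (a + quarter m).
rewrite opprD addrCA subrr addr0 zabsN => h2.
move: h1 h2; rewrite -!(ler_nat R) !natrD => h1 h2.
by rewrite /sawtooth ler_norml; apply/andP; split; lra.
Qed.

Lemma sawtooth_slope a : (zabs a + 2 <= m %/ 4)%N ->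
  sawtooth (a + Zmod1 m) - sawtooth (a - Zmod1 m) = 2.
Proof. by move=> /zabs_shift h; rewrite /sawtooth h natrD; ring. Qed.

Lemma sawtooth_lip a : `|sawtooth (a + Zmod1 m) - sawtooth (a - Zmod1 m)| <= 2.
Proof.
have := zabs_le_add (a + Zmod1 m + quarter m) (a - Zmod1 m + quarter m).
have := zabs_le_add (a - Zmod1 m + quarter m) (a + Zmod1 m + quarter m).
set p := a + Zmod1 m + quarter m; set q := a - Zmod1 m + quarter m.
have -> : q - p = - (Zmod1 m + Zmod1 m).
  by rewrite /p /q opprD addrACA subrr addr0 opprD addrACA subrr add0r opprD.
have -> : p - q = Zmod1 m + Zmod1 m.
  by rewrite /p /q opprD addrACA subrr addr0 opprD addrACA subrr add0r opprK.
rewrite zabsN => h1 h2.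
have h := zabsD (Zmod1 m) (Zmod1 m); have := zabs1 m => h0.
have {}h1 : (zabs q <= zabs p + 2)%N by lia.
have {}h2 : (zabs p <= zabs q + 2)%N by lia.
move: h1 h2; rewrite -!(ler_nat R) !natrD => h1 h2.
by rewrite /sawtooth -/p -/q ler_norml; apply/andP; split; lra.
Qed.

Definition signed_sum b y : R := \sum_k sg b k * sawtooth (y 0 k).

Lemma sum_signed_sum_sqr y :
  \sum_(b : signs n) signed_sum b y ^+ 2 <=
  #|{: signs n}|%:R * (n%:R * (supabs y)%:R ^+ 2).
Proof.
rewrite sum_sg_sqr ler_wpM2l//.
rewrite -[n in leRHS]card_ord mulr_natl -sumr_const; apply: ler_sum => k _.
rewrite -real_normK ?num_real// lerXn2r ?nnegrE//.
by rewrite (le_trans (sawtooth_le _))// ler_nat zabs_supabs.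
Qed.

Lemma signed_sum_step b u j :
  sg b j * (signed_sum b (u + e_ m j) - signed_sum b (u - e_ m j)) =
  sawtooth (u 0 j + Zmod1 m) - sawtooth (u 0 j - Zmod1 m).
Proof.
rewrite /signed_sum -sumrB (bigD1 j)//= big1 ?addr0; last first.
  by move=> k /negbTE kj; rewrite !mxE kj subr0 addr0 subrr.
by rewrite !mxE eqxx -mulrBr mulrA sgM mul1r.
Qed.

(** The function on the torus which detects non-smoothness: it is bounded by 1,
    whereas its signed gradient against the signs [b] has no negative term
    near 0. *)
Definition wave (theta : R) b y : R := clip (theta * signed_sum b y).

(** Each term of the signed gradient is [2 * theta] unless the truncation
    interferes. Averaged over the signs, the argument of the truncation has
    variance at most [theta ^+ 2 * n * supabs u ^+ 2], so for [supabs u] of order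
    [K] and [theta] of order [1 / (K * Num.sqrt n)] the truncation costs at most
    half. For larger [u] only the Lipschitz bound is left. The right-hand factor
    is affine in [supabs u] in order that the first moment of [supabs], which is
    all that the approximation property controls, suffices. *)
Lemma sum_wave_step (theta K : R) (j : 'I_n) u : 0 < theta -> 1 <= K ->
  6 * K + 2 < (m %/ 4)%:R -> theta ^+ 2 * (n%:R * K ^+ 2) * 196 <= 1 ->
  #|{: signs n}|%:R * (theta * (1 - (supabs u)%:R / (2 * K))) <=
  \sum_(b : signs n)
    sg b j * (wave theta b (u + e_ m j) - wave theta b (u - e_ m j)).
Proof.
move=> t0 K1 Km tn; have N0 : 0 <= #|{: signs n}|%:R :> R by [].
set D := BIG_F.
have K0 : 0 < K by lra.
(* The bounds cross at 6 * K: there the affine factor is 1 - 3 = -2, the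
   trivial Lipschitz bound. *)
have [near|far] := leP (supabs u)%:R (6 * K); last first.
  have Dle b : - (2 * theta) <= D b.
    have Zle : `|signed_sum b (u + e_ m j) - signed_sum b (u - e_ m j)| <= 2.
      have := sawtooth_lip (u 0 j).
      by rewrite -(signed_sum_step b) normrM normr_sign mul1r.
    rewrite lerNl (le_trans (ler_norm _))// normrN /D normrM normr_sign mul1r.
    rewrite (le_trans (clip_dist _ _))// -mulrBr normrM gtr0_norm//.
    by rewrite [leRHS]mulrC ler_pM2l.
  apply: (@le_trans _ _ (\sum_(b : signs n) - (2 * theta)));
    last exact: ler_sum.
  rewrite sumr_const -[leRHS]mulr_natl ler_wpM2l//.
  suff : 3 <= (supabs u)%:R / (2 * K) by nra.
  by rewrite ler_pdivlMr; lra.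
have slope : sawtooth (u 0 j + Zmod1 m) - sawtooth (u 0 j - Zmod1 m) = 2.
  apply: sawtooth_slope; rewrite -(ler_nat R) natrD.
  have := zabs_supabs u j; rewrite -(ler_nat R); lra.
set T := fun y => \sum_(b : signs n) signed_sum b y ^+ 2.
apply: (@le_trans _ _ (2 * theta * (#|{: signs n}|%:R -
    theta ^+ 2 * (T (u + e_ m j) + T (u - e_ m j))))).
  (* u + v has supremum at most 6 * K + 1 <= 7 * K, and 196 = 4 * 7 ^ 2 makes
     the two second moments cost at most one half. *)
  have rK (v : torus m n) : (supabs v <= 1)%N ->
      T (u + v) <= #|{: signs n}|%:R * (n%:R * (7 * K) ^+ 2).
    move=> v1; rewrite (le_trans (sum_signed_sum_sqr _))// !ler_wpM2l//.
    rewrite lerXn2r ?nnegrE ?mulr_ge0//; try lra.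
    have := leq_trans (supabsD u v) (leq_add (leqnn _) v1).
    rewrite -(ler_nat R) natrD; lra.
  have r1 := rK _ (supabs_e j).
  have r2 := rK (- e_ m j); rewrite supabsN in r2; have {}r2 := r2 (supabs_e j).
  have t2 : 0 <= theta ^+ 2 by exact: sqr_ge0.
  have := ler_wpM2l t2 (lerD r1 r2).
  have := ler_wpM2l N0 tn.
  rewrite mulrCA (mulrC theta) -!mulrA (mulrC 2).
  rewrite mulrA (mulrC _ theta) -!mulrA ler_pM2l// => h1 h2.
  have q0 : 0 <= (supabs u)%:R / (2 * K) by rewrite divr_ge0//; lra.
  have := ler_wpM2l N0 q0.
  nra.
have -> : 2 * theta * (#|{: signs n}|%:R -
      theta ^+ 2 * (T (u + e_ m j) + T (u - e_ m j))) =
    \sum_(b : signs n) 2 * theta *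
      (1 - (theta * signed_sum b (u + e_ m j)) ^+ 2 -
       (theta * signed_sum b (u - e_ m j)) ^+ 2).
  rewrite -mulr_sumr; congr (_ * _).
  rewrite !sumrB sumr_const mulrDr opprD addrA /T !mulr_sumr.
  by congr (_ - _ - _); apply: eq_bigr => b _; rewrite exprMn.
apply: ler_sum => b _; rewrite /D /wave.
have := signed_sum_step b u j; rewrite slope.
set p := signed_sum b _; set q := signed_sum b _; rewrite /sg.
case: (b j); rewrite ?expr1 ?expr0 ?mulN1r ?mul1r => pq.
  have e : theta * q - theta * p = 2 * theta.
    by rewrite -mulrBr -opprB pq mulrC.
  have /clip_slope : theta * p <= theta * q by lra.
  by rewrite e => h; lra.
have e : theta * p - theta * q = 2 * theta.
  by rewrite -mulrBr pq mulrC.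
have /clip_slope : theta * q <= theta * p by lra.
by rewrite e.
Qed.

End torus.

(** * Integrals over finite probability spaces *)

(** The bijection [e] links the measurable structure of [T] with the finite
    structure of [I]; in the applications it is the identity of a type which
    bears both. *)
Section mass.
Context {R : realType} d (T : measurableType d) (I : finType) (e : I -> T).
Hypothesis mT : forall B : set T, measurable B.
Hypothesis be : bijective e.
Variable P : probability T R.

Definition mass (t : T) : R := fine (P [set t]%classic).

Lemma mass_ge0 t : 0 <= mass t.
Proof. exact: fine_ge0. Qed.

Lemma EFin_mass t : (mass t)%:E = P [set t]%classic.
Proof. by rewrite /mass fineK// fin_num_measure. Qed.

Lemma Rintegral_mass (f : T -> R) : (forall t, 0 <= f t) ->
  Rintegral P setT f = \sum_(i : I) mass (e i) * f (e i).
Proof.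
move=> f0; have [e' eK e'K] := be.
have fE t : (f t)%:E = (\sum_(i : I) (f (e i) * \1_[set e i]%classic t)%:E)%E.
  rewrite (bigD1 (e' t))//= e'K indicE mem_set//= mulr1 big1 ?adde0//.
  move=> i iN; rewrite indicE memNset ?mulr0//= => tE.
  by move: iN; rewrite tE eK eqxx.
rewrite /Rintegral (eq_integral _ _ (fun t _ => fE t)) ge0_integral_sum//.
- rewrite -[RHS]/(fine _%:E) -sumEFin; congr fine; apply: eq_bigr => i _.
  rewrite (@integralZl_indic _ _ _ _ _ _ (fun=> [set e i]%classic))//.
    rewrite integral_indic// setIT mulrC EFinM; congr (_ * _)%E.
    exact/esym/EFin_mass.
  by move=> /(le_lt_trans (f0 _)); rewrite ltxx.
- by move=> i _ B _; exact: mT.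
- by move=> i t _; rewrite lee_fin mulr_ge0.
Qed.

Lemma sum_mass : \sum_(i : I) mass (e i) = 1.
Proof.
have := Rintegral_mass (fun=> ler01); rewrite Rintegral_cst//= probability_setT.
rewrite /= mulr1 => ->.
by apply: eq_bigr => i _; rewrite mulr1.
Qed.

Lemma Rintegral_le_cst (f : T -> R) (C : R) : (forall t, 0 <= f t <= C) ->
  Rintegral P setT f <= C.
Proof.
move=> fC; rewrite Rintegral_mass => [|t]; last by case/andP: (fC t).
rewrite -[leRHS]mul1r -sum_mass mulr_suml; apply: ler_sum => i _.
by rewrite ler_wpM2l ?mass_ge0//; case/andP: (fC (e i)).
Qed.

End mass.

(** All singletons have the same mass, and the masses add up to 1, so the
    normalizing constant never has to be evaluated. *)
Lemma mass_uniform {R : realType} d (T : measurableType d) (I : finType)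
    (e : I -> T) (mT : forall B : set T, measurable B) (be : bijective e) i :
  mass (uniform T : probability T R) (e i) = #|I|%:R^-1.
Proof.
have mc j : mass (uniform T : probability T R) (e j) =
    mass (uniform T : probability T R) (e i).
  rewrite /mass /uniform /= /mnormalize.
  have [e' eK e'K] := be.
  have fT : finite_set [set: T]%classic.
    have -> : [set: T]%classic = (e @` [set: I])%classic.
      by apply/seteqP; split => t //= _; exists (e' t).
    exact: finite_image.
  have cT : (0 < @counting T R [set: T] < +oo)%E.
    rewrite /counting asboolT// lte_fin ltr0n ltry andbT.
    rewrite lt0n finmap.cardfs_eq0; apply/eqP => /(fset_set_set0 fT) T0.
    by have : [set: T]%classic (e i) by []; rewrite T0.
  rewrite ifN; last first.
    by rewrite negb_or; case/andP: cT => c0 c1; rewrite gt_eqF// lt_eqF.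
  have c1 k :
      (@counting T R : {measure set T -> \bar R}) [set e k]%classic = 1%E.
    by rewrite /= /counting asboolT// fset_set1 finmap.cardfs1.
  by rewrite !c1.
have := sum_mass mT be (uniform T : probability T R).
rewrite (eq_bigr _ (fun j _ => mc j)) sumr_const => h.
by apply/esym/mulr1_eq; rewrite mulr_natl.
Qed.

(** * Jensen's inequality for powers *)

Section jensen.
Context {R : realType}.

(** Young's inequality between [t] and 1, with conjugate exponents. *)
Lemma powR_tangent (q t : R) : 1 <= q -> 0 <= t -> q * (t - 1) <= t `^ q - 1.
Proof.
rewrite le_eqVlt => /predU1P[<-|q1] t0; first by rewrite mul1r powRr1.
have q0 : 0 < q by lra.
have p0 : 0 < (q / (q - 1)) by rewrite divr_gt0// subr_gt0.
have pq : q^-1 + (q / (q - 1))^-1 = 1.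
  by rewrite invf_div; field; rewrite gt_eqF//.
have := conjugate_powR t0 ler01 q0 p0 pq.
rewrite mulr1 powR1 mul1r invf_div => h.
have : q * t <= q * (t `^ q / q + (q - 1) / q) by rewrite ler_pM2l.
rewrite mulrDr !(mulrCA q) divff ?gt_eqF// !mulr1; lra.
Qed.

(** The tangent inequality at [t i / M], averaged: the power mean being at most
    [M], the mean of [t i / M - 1] is nonpositive. *)
Lemma powR_mean_le (I : finType) (w t : I -> R) (q M : R) :
  1 <= q -> 0 < M -> (forall i, 0 <= w i) -> \sum_i w i = 1 ->
  (forall i, 0 <= t i) -> \sum_i w i * (t i) `^ q <= M `^ q ->
  \sum_i w i * t i <= M.
Proof.
move=> q1 M0 w0 w1 t0 tM.
have Mq0 : 0 < M `^ q by exact: powR_gt0.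
suff : q * (\sum_i w i * t i / M - 1) <= 0.
  rewrite pmulr_rle0 ?subr_le0 ?(lt_le_trans ltr01)//.
  by rewrite -mulr_suml ler_pdivrMr// mul1r.
have -> : q * (\sum_i w i * t i / M - 1) = \sum_i w i * (q * (t i / M - 1)).
  rewrite -[X in _ - X]w1 -sumrB mulr_sumr; apply: eq_bigr => i _; ring.
apply: (@le_trans _ _ (\sum_i w i * ((t i / M) `^ q - 1))).
  apply: ler_sum => i _; rewrite ler_wpM2l// powR_tangent// divr_ge0//.
  exact: ltW.
under eq_bigr do rewrite mulrBr mulr1.
rewrite sumrB w1 subr_le0.
have E i : w i * (t i / M) `^ q = w i * t i `^ q / M `^ q.
  have M0' : 0 <= M by exact: ltW.
  by rewrite powRM ?invr_ge0// -powR_inv1// -powRrM mulN1r powRN mulrA.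
by rewrite (eq_bigr _ (fun i _ => E i)) -mulr_suml ler_pdivrMr// mul1r.
Qed.

End jensen.

(** * Finite-dimensional supremum-norm spaces as targets *)

HB.instance Definition _ (R : realType) (m n : nat) :=
  Complete.on 'M[R]_(m, n).

Section linf.
Context {R : realType} {T : finType}.

Definition linf : completeNormedModType R := 'rV[R]_#|T|.

Definition to_linf (v : T -> R) : linf := \row_i v (enum_val i).

Definition coord (t : T) (x : linf) : R := (x : 'rV[R]_#|T|) 0 (enum_rank t).

Lemma coord_to_linf v t : coord t (to_linf v) = v t.
Proof. by rewrite /coord mxE enum_rankK. Qed.

Lemma coord_is_linear t : linear (coord t).
Proof. by move=> a x y; rewrite /coord !mxE. Qed.

HB.instance Definition _ t :=
  GRing.isLinear.Build R linf R _ (coord t) (coord_is_linear t).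

Lemma coord_le_norm t (x : linf) : `|coord t x| <= `|x|.
Proof.
rewrite [leRHS]/Num.norm /= mx_normrE.
exact: (le_bigmax _
  (fun i : 'I_1 * 'I_#|T| => `|(x : 'rV[R]_#|T|) i.1 i.2|) (0, enum_rank t)).
Qed.

Lemma linf_norm_le (x : linf) C : 0 <= C ->
  (forall t, `|coord t x| <= C) -> `|x| <= C.
Proof.
move=> C0 xC; rewrite [leLHS]/Num.norm /= mx_normrE.
apply/bigmax_leP; split => // -[i k] _ /=.
by rewrite (ord1 i); have := xC (enum_val k); rewrite /coord enum_valK.
Qed.

End linf.
Arguments linf R T : clear implicits.

Lemma sum_pair (V : nmodType) (I J : finType) (g : I * J -> V) :
  \sum_i g i = \sum_i \sum_j g (i, j).
Proof. by rewrite pair_bigA; apply: eq_bigr => -[]. Qed.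

(** * The two properties of a scheme tested on such spaces *)

(** For a map into a supremum-norm space, the norm on the left of either property
    may be replaced by a coordinate that depends on the point of integration. *)
Section test.
Context {R : realType} {m n : nat} {T : finType}.
Variables (F : torus m n -> T -> R) (C : R).
Hypothesis C0 : 0 < C.
Hypothesis FC : forall p, edge p -> forall t, `|F p.1 t - F p.2 t| <= C.

Let f (x : torus m n) : linf R T := to_linf (F x).

Lemma coord_conv (nu : probability (torus m n) R) x t :
  coord t (Defs.conv f nu x) = \sum_(y : torus m n) mass nu y * F (x - y) t.
Proof.
rewrite /Defs.conv linear_sum; apply: eq_bigr => y _.
by rewrite linearZ /f/= coord_to_linf.
Qed.

Lemma edge_energy_le q (beta : probability (Einfty m n) R) : 0 <= q ->
  edge_energy q beta f <= C `^ q.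
Proof.
move=> q0; apply: (@Rintegral_le_cst _ _ _ (Einfty m n) id) => //.
  by exists id.
move=> p; rewrite powR_ge0 ge0_ler_powR// ?nnegrE ?(ltW C0)//.
apply: linf_norm_le => [|t]; first exact: ltW.
by rewrite linearB/= !coord_to_linf FC//; exact: valP.
Qed.

(** Jensen's inequality removes the power [q] from both sides. *)
Lemma approximation_mean q A nu beta : (0 < n)%N -> 1 <= q -> 0 < A ->
  approximation_property q A nu beta f ->
  forall s : torus m n -> T,
  \sum_(j < n) \sum_(x : torus m n) mass (@mu R m n) x *
    `|\sum_(y : torus m n) mass (nu j) y * F (x - y) (s x) - F x (s x)|
  <= n%:R * (A * C).
Proof.
move=> n0 q1 A0 approx s; have n0' : 0 < n%:R :> R by rewrite ltr0n.
have q0 : 0 <= q by lra.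
have bid : bijective (@id (torus m n)) by exists id.
pose w (i : 'I_n * torus m n) : R := n%:R^-1 * mass (@mu R m n) i.2.
pose t (i : 'I_n * torus m n) : R := `|Defs.conv f (nu i.1) i.2 - f i.2|.
have sumw : \sum_i w i = 1.
  rewrite sum_pair /w/=.
  have sm : \sum_(x : torus m n) mass (@mu R m n) x = 1.
    by apply: (@sum_mass _ _ _ (torus m n) id) => //; exists id.
  under eq_bigr do rewrite -mulr_sumr sm.
  by rewrite sumr_const card_ord mulr1 -[LHS]mulr_natl mulfV ?gt_eqF.
have : \sum_i w i * t i <= A * C.
  apply: (powR_mean_le q1) => //; first exact: mulr_gt0.
  - by move=> i; rewrite mulr_ge0 ?invr_ge0 ?mass_ge0.
  - by move=> i; exact: normr_ge0.
  rewrite sum_pair/= powRM ?(ltW C0) ?(ltW A0)//.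

  apply: (le_trans _ (le_trans approx _)); last first.
    by rewrite ler_wpM2l ?powR_ge0// edge_energy_le.
  rewrite mulr_sumr; apply: ler_sum => j _.
  rewrite (@Rintegral_mass _ _ _ (torus m n) id _ bid);
    [|by []|by move=> x; exact: powR_ge0].
  by rewrite mulr_sumr; apply: ler_sum => x _; rewrite /w mulrA.
rewrite sum_pair/= => h.
rewrite -ler_pdivrMl// mulr_sumr; apply: le_trans h.
apply: ler_sum => j _; rewrite mulr_sumr; apply: ler_sum => x _.
rewrite /w /= -mulrA !ler_wpM2l ?invr_ge0 ?mass_ge0// /t/=.
rewrite (le_trans _ (coord_le_norm (s x) _))// linearB/= coord_conv.
by rewrite coord_to_linf.
Qed.

Lemma smoothing_mean q S nu beta : 1 <= q -> 0 < S ->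
  smoothing_property q S nu beta f ->
  forall s : torus m n -> signs n -> T,
  \sum_(x : torus m n) \sum_(b : signs n)
    mass (@mu R m n) x * mass (@tau R n) b *
    (\sum_(j < n) (-1) ^+ b j * \sum_(y : torus m n) mass (nu j) y *
       (F (x + e_ m j - y) (s x b) - F (x - e_ m j - y) (s x b))) <= S * C.
Proof.
move=> q1 S0 smooth s; have q0 : 0 <= q by lra.
have bid : bijective (@id (torus m n)) by exists id.
have bids : bijective (@id (signs n)) by exists id.
pose w (i : torus m n * signs n) : R :=
  mass (@mu R m n) i.1 * mass (@tau R n) i.2.
pose v (x : torus m n) (b : signs n) : linf R T :=
  \sum_(j < n) (-1) ^+ b j *:
    (Defs.conv f (nu j) (x + e_ m j) - Defs.conv f (nu j) (x - e_ m j)).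
pose t (i : torus m n * signs n) : R := `|v i.1 i.2|.
have sumw : \sum_i w i = 1.
  rewrite sum_pair /w/=.
  have sm : \sum_(b : signs n) mass (@tau R n) b = 1.
    by apply: (@sum_mass _ _ _ (signs n) id) => //; exists id.
  under eq_bigr do rewrite -mulr_sumr sm mulr1.
  by rewrite (@sum_mass _ _ _ (torus m n) id)//; exists id.
have : \sum_i w i * t i <= S * C.
  apply: (powR_mean_le q1) => //; first exact: mulr_gt0.
  - by move=> i; rewrite mulr_ge0 ?mass_ge0.
  - by move=> i; exact: normr_ge0.
  rewrite sum_pair/= powRM ?(ltW C0) ?(ltW S0)//.

  apply: (le_trans _ (le_trans smooth _)); last first.
    by rewrite ler_wpM2l ?powR_ge0// edge_energy_le.
  rewrite (@Rintegral_mass _ _ _ (torus m n) id _ bid); [|by []|]; last first.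
    by move=> x; apply: Rintegral_ge0 => b _; exact: powR_ge0.
  apply: ler_sum => x _.
  rewrite (@Rintegral_mass _ _ _ (signs n) id _ bids);
    [|by []|by move=> b; exact: powR_ge0].
  by rewrite mulr_sumr; apply: ler_sum => b _; rewrite /w mulrA.
rewrite sum_pair/=; apply: le_trans.
apply: ler_sum => x _; apply: ler_sum => b _.
rewrite ler_wpM2l ?mulr_ge0 ?mass_ge0// /t/=.
rewrite (le_trans _ (coord_le_norm (s x b) _))// (le_trans _ (ler_norm _))//.
rewrite /v linear_sum/=; apply: ler_sum => j _.
rewrite linearZ/= linearB/= !coord_conv -sumrB.
by under eq_bigr do rewrite mulrBr.
Qed.

End test.

(** * The lower bound *)

Section conclusion.
Context {R : realType} {m n : nat}.
Variables (q A S : R) (nu : 'I_n -> probability (torus m n) R).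
Variables (beta1 beta2 : probability (Einfty m n) R).
Hypotheses (n0 : (0 < n)%N) (q1 : 1 <= q) (A1 : 1 <= A) (S1 : 1 <= S).
Hypothesis scheme : smoothing_approximation_scheme q A S nu beta1 beta2.

(** The test map is the Kuratowski embedding [x |-> (z |-> supabs (x - z))], which
    is 1-Lipschitz along edges. At the coordinate [z = x] the deviation of the
    convolution from the map is exactly the first moment of [supabs]. *)
Lemma mean_supabs :
  \sum_(j < n) \sum_(y : torus m n) mass (nu j) y * (supabs y)%:R <= n%:R * A.
Proof.
pose F (x z : torus m n) : R := (supabs (x - z))%:R.
have FC p : edge p -> forall z, `|F p.1 z - F p.2 z| <= 1.
  move=> /supabs_edge ep z.
  have h1 := supabsD (p.1 - p.2) (p.2 - z).
  have h2 := supabsD (- (p.1 - p.2)) (p.1 - z).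
  move: h1 h2; rewrite supabsN opprB !addrA !subrK => h1 h2.
  move: ep h1 h2; rewrite -!(ler_nat R) !natrD => ep h1 h2.
  by rewrite /F ler_norml; apply/andP; split; lra.
have [approx _] := scheme (fun x => to_linf (F x)).
have A0 : 0 < A := lt_le_trans ltr01 A1.
have := approximation_mean ltr01 FC n0 q1 A0 approx id.
rewrite mulr1; apply: le_trans; apply: ler_sum => j _.
have sm : \sum_(x : torus m n) mass (@mu R m n) x = 1.
  by apply: (@sum_mass _ _ _ (torus m n) id) => //; exists id.
rewrite -[leLHS]mul1r -[X in X * _ <= _]sm mulr_suml; apply: ler_sum => x _.
rewrite ler_wpM2l ?mass_ge0// (le_trans _ (ler_norm _))//.
rewrite /F subrr supabs0 subr0.
by apply: ler_sum => y _; rewrite addrAC subrr add0r supabsN.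
Qed.

(** The test map has all the translates of all the waves as coordinates. It has
    oscillation at most 2, while at [x] and signs [b] the wave of signs [b]
    centred at [x] sees the whole signed gradient. *)
Lemma mean_wave_step (theta : R) : 0 < theta ->
  6 * A + 2 < (m %/ 4)%:R -> theta ^+ 2 * (n%:R * A ^+ 2) * 196 <= 1 ->
  theta * n%:R / 2 <= S * 2.
Proof.
move=> t0 Am tn.
pose F (x : torus m n) (t : torus m n * signs n) : R :=
  wave theta t.2 (x - t.1).
have FC p : edge p -> forall z, `|F p.1 z - F p.2 z| <= 2.
  move=> _ z; rewrite (le_trans (ler_normB _ _))// -[2]/(1 + 1).
  by rewrite lerD// clip_bound.
have [_ smooth] := scheme (fun x => to_linf (F x)).
have S0 : 0 < S := lt_le_trans ltr01 S1.
have := smoothing_mean (ltr0n R 2) FC q1 S0 smooth pair.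
have sm : \sum_(x : torus m n) mass (@mu R m n) x = 1.
  by apply: (@sum_mass _ _ _ (torus m n) id) => //; exists id.
have N0 : 0 < #|{: signs n}|%:R :> R.
  by rewrite ltr0n; apply/card_gt0P; exists [ffun=> false].
apply: le_trans; rewrite -[leLHS]mul1r -[X in X * _ <= _]sm mulr_suml.
apply: ler_sum => x _.
under eq_bigr do rewrite -mulrA.
rewrite -mulr_sumr ler_wpM2l ?mass_ge0//.
under eq_bigr => b _.
  rewrite (@mass_uniform _ _ _ (signs n) id)//; last by exists id.
  over.
rewrite -mulr_sumr ler_pdivlMl//.
set N := #|{: signs n}|%:R : R.
apply: (@le_trans _ _ (\sum_(j < n) \sum_(y : torus m n)
    mass (nu j) y * (N * (theta * (1 - (supabs y)%:R / (2 * A)))))).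
  have -> : \sum_(j < n) \sum_(y : torus m n)
      mass (nu j) y * (N * (theta * (1 - (supabs y)%:R / (2 * A)))) =
      N * theta * (n%:R - (\sum_(j < n) \sum_(y : torus m n)
        mass (nu j) y * (supabs y)%:R) / (2 * A)).
    have nE : n%:R = \sum_(j < n) \sum_(y : torus m n) mass (nu j) y.
      under eq_bigr => j _.
        rewrite (@sum_mass _ _ _ (torus m n) id)//; last by exists id.
        over.
      by rewrite sumr_const card_ord.
    rewrite nE mulr_suml -sumrB mulr_sumr; apply: eq_bigr => j _.
    rewrite mulr_suml -sumrB mulr_sumr; apply: eq_bigr => y _; ring.
  rewrite -!mulrA ler_wpM2l ?(ltW N0)// ler_wpM2l ?(ltW t0)//.
  have A0 : 0 < 2 * A by rewrite mulr_gt0// (lt_le_trans ltr01).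
  have : (\sum_(j < n) \sum_(y : torus m n) mass (nu j) y * (supabs y)%:R) /
      (2 * A) <= n%:R / 2.
    by rewrite ler_pdivrMr// mulrA divfK// mean_supabs.
  lra.
rewrite [leRHS]exchange_big; apply: ler_sum => j _.
under [leRHS]eq_bigr do rewrite mulr_sumr.
rewrite [leRHS]exchange_big; apply: ler_sum => y _.
under [leRHS]eq_bigr do rewrite mulrCA.
rewrite -mulr_sumr ler_wpM2l ?mass_ge0//.
have -> : supabs y = supabs (- y) by rewrite supabsN.
apply: le_trans (sum_wave_step j (- y) t0 A1 Am tn) _.
(* The variable of integration enters the convolution with a minus sign. *)
have shift (v : torus m n) : x + v - y - x = - y + v.
  by rewrite addrAC (addrAC x) subrr add0r addrC.
by apply: ler_sum => b _; rewrite /F/= !shift.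
Qed.

End conclusion.

Theorem proposition4p1 (R : realType) :
  exists c : R, 0 < c /\
    forall q : R, 1 <= q ->
      exists kappa : R, 0 < kappa /\
        forall (n m : nat) (A S : R)
          (nu : 'I_n -> probability (torus m n) R)
          (beta1 beta2 : probability (Einfty m n) R),
          (0 < n)%N -> (0 < m)%N -> 1 <= A -> 1 <= S ->
          smoothing_approximation_scheme q A S nu beta1 beta2 ->
          c * A < m%:R ->
          kappa * (Num.sqrt n%:R / A) <= S.
Proof.
exists 36; split => // q q1; exists 56^-1; split; first by rewrite invr_gt0.
move=> n m A S nu beta1 beta2 n0 _ A1 S1 scheme Am.
have A0 : 0 < A by lra.
set r := Num.sqrt n%:R; have r0 : 0 < r by rewrite sqrtr_gt0 ltr0n.
have rr : r * r = n%:R by rewrite -expr2 sqr_sqrtr.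
(* The largest scale that the variance bound allows, as 14 ^ 2 = 196; the
   resulting constant is 56 = 14 * 2 * 2. *)
pose theta := (14 * A * r)^-1.
have t0 : 0 < theta by rewrite invr_gt0 !mulr_gt0.
have tAr : theta * A * r = 14^-1 by rewrite /theta; field; rewrite !gt_eqF.
(* m %/ 4 exceeds m / 4 - 1 > 9 * A - 1, and 3 * A >= 3. *)
have m4 : 6 * A + 2 < (m %/ 4)%:R.
  have : (m <= 4 * (m %/ 4) + 3)%N by lia.
  by rewrite -(ler_nat R) natrD natrM; lra.
have tn : theta ^+ 2 * (n%:R * A ^+ 2) * 196 <= 1.
  have -> : theta ^+ 2 * (n%:R * A ^+ 2) = (theta * A * r) ^+ 2.
    by rewrite -rr; ring.
  by rewrite tAr; lra.
have := mean_wave_step n0 q1 A1 S1 scheme t0 m4 tn.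
have -> : theta * n%:R = 14^-1 * (r / A).
  by rewrite -tAr -rr; field; rewrite gt_eqF.
lra.
Qed.
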